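(* Let $k\ge 2$, and let $C$ be a linear code of length $n$ and dimension $k$ over $GF(q)$ with a $k\times n$ generator matrix $G=(a_{ji})$ of rank $k$ such that $a_{2i}=1$ for all $1\le i\le n$. Let $C_1$ be the Bruen-Silverman code associated with $C$ (with hyperplanes labelled by means of the line $\ell$ described in the context). Then $C_1$ is identical to $C$. In particular, $C_1$ is linear.
   Context: Construction of $C_1$. Let $\Sigma=PG(k,q)$ have homogeneous coordinates $(x_1,\dots,x_{k+1})$, and let $\Sigma_\infty$ be the hyperplane $x_{k+1}=0$. For $1\le i\le n$ let $\Pi_i\subset\Sigma_\infty$ be the $(k-2)$-dimensional projective subspace defined by $x_{k+1}=0$ and $a_{1i}x_1+a_{2i}x_2+\cdots+a_{ki}x_k=0$. Let $E=\Sigma\setminus\Sigma_\infty$, whose points are $(\alpha_1,\dots,\alpha_k,1)$. Let $U=(0,1,0,\dots,0)$ and $V=(0,\dots,0,1)$, and let $\ell=UV$, so the points of $\ell$ in $E$ are $(0,\gamma,0,\dots,0,1)$, $\gamma\in GF(q)$. (Since $a_{2i}\ne 0$, $U$ lies on no $\Pi_i$.) For $P\in E$ let $H_i(P)$ be the unique hyperplane of $\Sigma$ containing $\Pi_i$ and $P$. It meets $\ell$ in a point $(0,\gamma_i,0,\dots,0,1)$ of $E$, and one associates with $P$ the word $(\gamma_1,\dots,\gamma_n)$. The Bruen-Silverman (BRS) code $C_1$ is the set of words obtained in this way as $P$ ranges over the $q^k$ points of $E$. *)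

(* Defs.v *)
From mathcomp Require Import all_boot all_order all_algebra.

Set Implicit Arguments.
Unset Strict Implicit.
Unset Printing Implicit Defensive.

Import GRing.Theory.
Local Open Scope ring_scope.

Definition is_linear_code (F : finFieldType) (n : nat)
    (S : 'rV[F]_n -> Prop) : Prop :=
  [/\ S 0, forall u v, S u -> S v -> S (u + v)
    & forall a u, S u -> S (a *: u)].

Definition generator_matrix (F : finFieldType) (k n : nat)
    (C : {vspace 'rV[F]_n}) (G : 'M[F]_(k, n)) : bool :=
  basis_of C [tuple row j G | j < k].

(* PG(k, F) is the lattice of subspaces of 'rV[F]_(k + 1); a subspace of     *)
(* projective dimension d has vector dimension d + 1.  The last coordinate   *)
(* x_(k+1) is the right block of 'rV_(k + 1).                                *)

Definition is_point (F : finFieldType) (k : nat)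
    (P : {vspace 'rV[F]_(k + 1)}) : Prop := \dim P = 1%N.

Definition is_hyperplane (F : finFieldType) (k : nat)
    (H : {vspace 'rV[F]_(k + 1)}) : Prop := \dim H = k.

(* The subspace of equation c_1 x_1 + ... + c_(k+1) x_(k+1) = 0. *)
Definition zeros (F : finFieldType) (k : nat) (c : 'cV[F]_(k + 1)) :
    {vspace 'rV[F]_(k + 1)} :=
  lker (linfun (mulmxr c : 'rV[F]_(k + 1) -> 'rV[F]_1)).

Definition Sigma_inf (F : finFieldType) (k : nat) :
    {vspace 'rV[F]_(k + 1)} := zeros (col_mx 0 1%:M).

Definition in_E (F : finFieldType) (k : nat)
    (P : {vspace 'rV[F]_(k + 1)}) : Prop :=
  is_point P /\ ~~ (P <= Sigma_inf F k)%VS.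

Definition Pi (F : finFieldType) (k n : nat) (G : 'M[F]_(k, n)) (i : 'I_n) :
    {vspace 'rV[F]_(k + 1)} :=
  (Sigma_inf F k :&: zeros (col_mx (col i G) 0))%VS.

(* Indices start at 0, so the second coordinate has index Ordinal hk. *)
Definition vecU (F : finFieldType) (k : nat) (hk : (2 <= k)%N) :
    'rV[F]_(k + 1) := row_mx (delta_mx 0 (Ordinal hk)) 0.

Definition vecV (F : finFieldType) (k : nat) : 'rV[F]_(k + 1) :=
  row_mx 0 1%:M.

Definition lineUV (F : finFieldType) (k : nat) (hk : (2 <= k)%N) :
    {vspace 'rV[F]_(k + 1)} := (<[vecU F hk]> + <[vecV F k]>)%VS.

(* The point (0, g, 0, ..., 0, 1) of the line UV. *)
Definition line_point (F : finFieldType) (k : nat) (hk : (2 <= k)%N) (g : F) :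
    {vspace 'rV[F]_(k + 1)} :=
  let v : 'rV[F]_(k + 1) := row_mx (g *: delta_mx 0 (Ordinal hk)) 1%:M in
  <[v]>%VS.

(* H is the unique hyperplane containing Pi_i and P. *)
Definition is_H (F : finFieldType) (k n : nat) (G : 'M[F]_(k, n)) (i : 'I_n)
    (P H : {vspace 'rV[F]_(k + 1)}) : Prop :=
  unique (fun H' => [/\ is_hyperplane H', (Pi G i <= H')%VS & (P <= H')%VS]) H.

Definition is_word (F : finFieldType) (k n : nat) (hk : (2 <= k)%N)
    (G : 'M[F]_(k, n)) (P : {vspace 'rV[F]_(k + 1)}) (w : 'rV[F]_n) : Prop :=
  forall i : 'I_n, exists H, is_H G i P H /\
    (H :&: lineUV F hk)%VS = line_point hk (w 0 i).

Definition BRS_code (F : finFieldType) (k n : nat) (hk : (2 <= k)%N)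
    (G : 'M[F]_(k, n)) (w : 'rV[F]_n) : Prop :=
  exists P, in_E P /\ is_word hk G P w.

(* Main.v *)
Require Import Defs.
From mathcomp Require Import all_boot all_order all_algebra.

Set Implicit Arguments.
Unset Strict Implicit.
Unset Printing Implicit Defensive.

Import GRing.Theory.
Local Open Scope ring_scope.

(** A point [P] of [E] is spanned by some vector [(a, 1)] ([in_EP]).
    Writing [c = (a *m G) 0 i], the hyperplane [a_1i x_1 + ... + a_ki x_k =
    c x_(k+1)] contains [P], and its part at infinity is [Pi_i]; since a vector
    of last coordinate [t] in it differs from [t *: (a, 1)] by a vector of
    [Pi_i], it is contained in, hence equal to, every hyperplane through [Pi_i]
    and [P] ([is_H_hyp]).  Because [a_2i = 1], it meets the line [UV] in the
    point [(0, c, 0, ..., 0, 1)] ([hyp_cap_line]).  So the word of [P] is the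
    codeword [a *m G] ([is_wordE]), and these are all the codewords of [C] as
    [a] varies ([generator_matrixP]). *)

Section BruenSilverman.

Variable F : finFieldType.

Lemma generator_matrixP (k n : nat) (C : {vspace 'rV[F]_n})
    (G : 'M[F]_(k, n)) (w : 'rV[F]_n) :
  generator_matrix C G -> w \in C <-> exists a : 'rV[F]_k, w = a *m G.
Proof.
move=> hG; have defC := span_basis hG; split=> [|[a ->]]; rewrite -defC.
  move/coord_span => ->; exists (\row_j coord [tuple row j G | j < k] j w).
  rewrite mulmx_sum_row; apply: eq_bigr => j _.
  by rewrite mxE -tnth_nth tnth_mktuple.
rewrite mulmx_sum_row; apply: memv_suml => j _; apply/memvZ/memv_span.
by apply/tnthP; exists j; rewrite tnth_mktuple.
Qed.

Section ProjectiveSpace.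

Variable k : nat.
Implicit Types (v : 'rV[F]_(k + 1)) (a : 'rV[F]_k).

Lemma mem_zeros (c : 'cV[F]_(k + 1)) v : (v \in zeros c) = (v *m c == 0).
Proof. by rewrite memv_ker lfunE. Qed.

(** A nonzero [c] defines a nonzero linear form, whose kernel has codimension
    one in a space of vector dimension [k + 1]. *)
Lemma dim_zeros (c : 'cV[F]_(k + 1)) : c != 0 -> \dim (zeros c) = k.
Proof.
move=> c_neq0; set f := linfun (mulmxr c : 'rV[F]_(k + 1) -> 'rV[F]_1).
have := limg_ker_dim f fullv.
rewrite capfv !dimvf /dim /= !mul1n -/(zeros c).
suff -> : \dim (limg f) = 1%N by move/eqP; rewrite eqn_add2r => /eqP.
apply/eqP; rewrite eqn_leq; apply/andP; split.
  by rewrite (leq_trans (dimvS (subvf _))) // dimvf.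
rewrite lt0n dimv_eq0; apply: contra_neq c_neq0 => img0.
apply/row_matrixP => i; rewrite row0 rowE.
have := memv_img f (memvf (delta_mx 0 i)).
by rewrite img0 memv0 lfunE => /eqP.
Qed.

Lemma mem_Sigma_inf v : (v \in Sigma_inf F k) = (rsubmx v == 0).
Proof.
by rewrite mem_zeros -{1}[v]hsubmxK mul_row_col mulmx0 add0r mulmx1.
Qed.

(** Every point of [E] has homogeneous coordinates normalised to [(a, 1)]. *)
Lemma in_EP (P : {vspace 'rV[F]_(k + 1)}) :
  in_E P <-> exists a, P = <[row_mx a 1%:M]>%VS.
Proof.
split=> [[dimP PnS]|[a ->]]; last first.
  have vnS : row_mx a 1%:M \notin Sigma_inf F k.
    by rewrite mem_Sigma_inf row_mxKr -scalemx1 scale1r oner_neq0.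
  split; last by rewrite -memvE.
  rewrite /is_point dim_vline; case: eqP => // v0.
  by rewrite v0 mem0v in vnS.
have [v vP vnS] := subvPn PnS.
have v_neq0 : v != 0 by apply: contraNneq vnS => ->; rewrite mem0v.
have defP : P = <[v]>%VS.
  by apply/esym/eqP; rewrite eqEdim -memvE vP dimP dim_vline v_neq0.
set t := rsubmx v 0 0.
have vr : rsubmx v = t%:M by rewrite [LHS]mx11_scalar.
have t_neq0 : t != 0.
  by apply: contraNneq vnS => t0; rewrite mem_Sigma_inf vr t0 raddf0.
exists (t^-1 *: lsubmx v).
have -> : row_mx (t^-1 *: lsubmx v) 1%:M = t^-1 *: v.
  by rewrite -[in RHS](hsubmxK v) scale_row_mx vr scale_scalar_mx mulVf.
apply/eqP; rewrite defP eqEdim -!memvE memvE.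
rewrite !dim_vline scaler_eq0 invr_eq0 (negPf t_neq0) v_neq0 leqnn andbT.
by rewrite -memvE -{1}[v]scale1r -(divff t_neq0) -scalerA memvZ ?memv_line.
Qed.

Section Word.

Variables (n : nat) (G : 'M[F]_(k, n)) (hk : (2 <= k)%N).
Hypothesis G2 : forall i, G (Ordinal hk) i = 1.

(** The hyperplane [a_1i x_1 + ... + a_ki x_k = c x_(k+1)]; [H_i(P)] for
    [P = (a, 1)] is the one with [c = (a *m G) 0 i]. *)
Definition hyp (i : 'I_n) (c : F) : {vspace 'rV[F]_(k + 1)} :=
  zeros (col_mx (col i G) (- c%:M)).

Lemma mem_hyp i c (x : 'rV[F]_k) (t : 'rV[F]_1) :
  (row_mx x t \in hyp i c) = ((x *m G) 0 i == t 0 0 * c).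
Proof.
rewrite mem_zeros mul_row_col mulmxN mul_mx_scalar subr_eq0.
have -> : (x *m G) 0 i = (x *m col i G) 0 0.
  by rewrite !mxE; apply: eq_bigr => j _; rewrite mxE.
rewrite mulrC; apply/eqP/eqP => [->|e]; first by rewrite mxE.
by apply/matrixP => r s; rewrite !ord1 e mxE.
Qed.

Lemma dim_hyp i c : \dim (hyp i c) = k.
Proof.
apply: dim_zeros; apply: contra_neq (oner_neq0 F); rewrite -(G2 i).
by rewrite -col_mx0 => /eq_col_mx[/matrixP/(_ (Ordinal hk) 0)]; rewrite !mxE.
Qed.

Lemma Pi_sub_hyp i c : (Pi G i <= hyp i c)%VS.
Proof.
apply/subvP => v; rewrite memv_cap mem_Sigma_inf mem_zeros -[v]hsubmxK.
rewrite row_mxKr => /andP[/eqP ->].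
by rewrite mem_zeros !mul_row_col !mul0mx.
Qed.

(** [H_i(P)] for [P = (a, 1)]; its uniqueness comes from comparing dimensions
    after an inclusion, so the dimension of [Pi_i] is not needed. *)
Lemma is_H_hyp i a :
  is_H G i <[row_mx a 1%:M]>%VS (hyp i ((a *m G) 0 i)).
Proof.
set p := row_mx a _; set c := _ 0 i.
have p_hyp : p \in hyp i c by rewrite mem_hyp [1%:M 0 0]mxE mul1r.
split=> [|H [dimH PiH pH]].
  by split; [exact: dim_hyp | exact: Pi_sub_hyp | rewrite -memvE].
apply/eqP; rewrite eqEdim dimH dim_hyp leqnn andbT.
apply/subvP => v v_hyp; set t := rsubmx v 0 0.
(* [v - t *: p] has last coordinate 0, so it lies in [Pi_i]. *)
rewrite -[v](subrK (t *: p)); apply: memvD; last by rewrite memvZ // memvE.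
apply: (subvP PiH); set u := v - _.
have u0 : rsubmx u = 0.
  by rewrite linearB linearZ /= row_mxKr scalemx1 -mx11_scalar subrr.
have : u \in hyp i c by rewrite memvB ?memvZ.
rewrite memv_cap mem_Sigma_inf u0 eqxx /= -[u]hsubmxK u0 !mem_zeros.
by rewrite !mul_row_col !mul0mx.
Qed.

Lemma hyp_cap_line i c : (hyp i c :&: lineUV F hk)%VS = line_point hk c.
Proof.
have eval (x : F) (t : 'M_1) :
    (row_mx (x *: delta_mx 0 (Ordinal hk)) t \in hyp i c) = (x == t 0 0 * c).
  by rewrite mem_hyp -scalemxAl -rowE !mxE G2 mulr1.
apply/eqP; rewrite eqEsubv; apply/andP; split; apply/subvP => v.
  rewrite memv_cap => /andP[v_hyp /memv_addP[_ /vlineP[x ->] [_ /vlineP[t ->]]]].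
  move=> defv; move: v_hyp; rewrite {v}defv /vecU /vecV.
  rewrite !scale_row_mx !scaler0 add_row_mx addr0 add0r eval scalemx1 mxE.
  move=> /eqP ->; apply/vlineP; exists t.
  by rewrite scale_row_mx scalerA scalemx1.
case/vlineP => t ->; rewrite memv_cap memvZ ?eval ?mxE ?mul1r //=.
rewrite memvZ //; apply/memv_addP.
exists (c *: vecU F hk); first by rewrite memvZ ?memv_line.
exists (vecV F k); first exact: memv_line.
by rewrite /vecU /vecV scale_row_mx add_row_mx scaler0 addr0 add0r.
Qed.

Lemma line_point_inj : injective (@line_point F k hk).
Proof.
move=> c d eq_cd.
have : row_mx (c *: delta_mx 0 (Ordinal hk)) 1%:M \in line_point hk d.
  by rewrite -eq_cd memv_line.
case/vlineP => t; rewrite scale_row_mx => /eq_row_mx[].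
move=> /matrixP/(_ 0 (Ordinal hk)) ec /matrixP/(_ 0 0).
by move: ec; rewrite !mxE !eqxx !mulr1 => -> <-; rewrite mul1r.
Qed.

(** The word associated with the point [(a, 1)] is the codeword of message [a]. *)
Lemma is_wordE a w : is_word hk G <[row_mx a 1%:M]>%VS w <-> w = a *m G.
Proof.
split=> [word_w | -> i]; last first.
  exists (hyp i ((a *m G) 0 i)).
  by split; [exact: is_H_hyp | exact: hyp_cap_line].
apply/rowP => i; have [H [[H_i H_uniq] H_line]] := word_w i.
have [hyp_i _] := is_H_hyp i a.
by apply: line_point_inj; rewrite -H_line (H_uniq _ hyp_i) hyp_cap_line.
Qed.

End Word.

End ProjectiveSpace.

End BruenSilverman.

Theorem theorem3p1 (F : finFieldType) (k n : nat) (hk : (2 <= k)%N)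
    (C : {vspace 'rV[F]_n}) (hC : \dim C = k)
    (G : 'M[F]_(k, n)) (hG : generator_matrix C G) (rkG : \rank G = k)
    (hG2 : forall i : 'I_n, G (Ordinal hk) i = 1) :
  (forall w : 'rV[F]_n, BRS_code hk G w <-> w \in C) /\
  is_linear_code (BRS_code hk G).
Proof.
have BRS_C w : BRS_code hk G w <-> w \in C.
  split=> [[P [/in_EP[a ->] /(is_wordE hG2) ->]]|/(generator_matrixP _ hG)[a ->]].
    by apply/(generator_matrixP _ hG); exists a.
  by exists <[row_mx a 1%:M]>%VS; split; [apply/in_EP; exists a | apply/is_wordE].
split=> //; split=> [|u v /BRS_C uC /BRS_C vC|b u /BRS_C uC]; apply/BRS_C.
- exact: mem0v.
- exact: memvD.
- exact: memvZ.
Qed.
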